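(* Let $F$ be a continuous distribution function on $\mathcal{X}\subseteq\mathbb{R}^p$ with finite energy distances. Suppose $n=\sum_{k=1}^K n_k(n)$ and $\lim_{n\to\infty}\frac{n_k(n)}{n}=c_k$ for $k=1,\ldots,K$. Let $S=\{k\in\{1,\ldots,K\}\mid c_k>0\}$. Let $\mathcal{P}_n^*=\bigcup_{k=1}^K\mathcal{P}^*_{n_k(n)}$, where $\mathcal{P}^*_{n_k(n)}\subseteq\mathcal{X}$ is a point set with $n_k(n)$ points. If for every $k\in S$ the subset $\mathcal{P}^*_{n_k(n)}$ is generated independently (i.e. separately from the other subsets) as a representative point set of $F$ under the energy distance criterion, that is, $$E(F,F_{\mathcal{P}^*_{n_k(n)}})=\min_{\mathcal{P}_{n_k(n)}\subseteq\mathcal{X}}E(F,F_{\mathcal{P}_{n_k(n)}}),$$ then $F_{\mathcal{P}_n^*}\stackrel{d}{\longrightarrow}F$ as $n\to\infty$.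
   Context: Point sets are finite indexed families of points (repetitions allowed and counted with multiplicity). $F_{\mathcal{P}}$ denotes the empirical distribution function of a point set $\mathcal{P}$. $K$ is fixed; $n_k(n)$ is the number of sample points in the $k$-th subset, a positive integer depending on the total sample size $n$. Unions of subsets are unions of indexed families, so the union has $\sum_k n_k(n)=n$ points. A minimum over $\mathcal{P}_m\subseteq\mathcal{X}$ ranges over all $m$-point sets in $\mathcal{X}$. For $Y,Y'\stackrel{i.i.d.}{\sim}F$, the energy distance between $F$ and $F_{\mathcal{P}_n}$, $\mathcal{P}_n=\{\boldsymbol{x}_i\}_{i=1}^n$, is $$E(F,F_{\mathcal{P}_n})=\frac{2}{n}\sum_{i=1}^n\mathbb{E}\|\boldsymbol{x}_i-Y\|_2-\frac{1}{n^2}\sum_{i=1}^n\sum_{j=1}^n\|\boldsymbol{x}_i-\boldsymbol{x}_j\|_2-\mathbb{E}\|Y-Y'\|_2 ,$$ assuming these expectations are finite. *)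

(* Defs.v *)
From HB Require Import structures.
From mathcomp Require Import all_boot all_order all_algebra.
From mathcomp Require Import all_classical all_reals all_analysis.

Set Implicit Arguments.
Unset Strict Implicit.
Unset Printing Implicit Defensive.

Import Order.TTheory GRing.Theory Num.Theory.
Import numFieldNormedType.Exports.

Local Open Scope classical_set_scope.
Local Open Scope ring_scope.

(* MathComp-Analysis gives 'rV[R]_p a topology but no sigma-algebra.  As it
   does for tuples, we use the one generated by the coordinates, which is the
   Borel sigma-algebra of R^p. *)
Section measurable_rV.
Context {R : realType} {p : nat}.

Let coord (i : 'I_p) (x : 'rV[R]_p) : R := x ord0 i.

Let rV_set0 : g_sigma_preimage coord set0.
Proof. exact: sigma_algebra0. Qed.

Let rV_setC A : g_sigma_preimage coord A -> g_sigma_preimage coord (~` A).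
Proof. exact: sigma_algebraC. Qed.

Let rV_bigcup (F : _^nat) : (forall i, g_sigma_preimage coord (F i)) ->
  g_sigma_preimage coord (\bigcup_i (F i)).
Proof. exact: sigma_algebra_bigcup. Qed.

HB.instance Definition _ := @isMeasurable.Build default_measure_display
  'rV[R]_p (g_sigma_preimage coord) rV_set0 rV_setC rV_bigcup.

Lemma measurable_rVE : @measurable _ 'rV[R]_p = g_sigma_preimage coord.
Proof. by []. Qed.

End measurable_rV.

(* The library norm `|x| on 'rV[R]_p is the sup norm. *)
Definition norm2 (R : realType) (p : nat) (x : 'rV[R]_p) : R :=
  Num.sqrt (\sum_(i < p) x ord0 i ^+ 2).

Definition lev (R : realType) (p : nat) (x y : 'rV[R]_p) : bool :=
  [forall i, x ord0 i <= y ord0 i].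

(* A distribution F on R^p is given as a probability measure; [mcdf F] is its
   joint distribution function.  The library's [cdf] is univariate. *)
Definition mcdf (R : realType) (p : nat) (F : probability 'rV[R]_p R)
    (x : 'rV[R]_p) : R :=
  fine (F [set y | lev y x]).

(* Point sets are families indexed by a finite type, so points are counted
   with multiplicity. *)
Definition edf (R : realType) (p : nat) (I : finType) (P : I -> 'rV[R]_p)
    (x : 'rV[R]_p) : R :=
  #|[pred i | lev (P i) x]|%:R / #|I|%:R.

Definition cvg_in_distribution (R : realType) (p : nat)
    (G : nat -> 'rV[R]_p -> R) (H : 'rV[R]_p -> R) : Prop :=
  forall x, {for x, continuous H} -> G n x @[n --> \oo] --> H x.

(* Two independent copies Y, Y' of F are the coordinates under F \x F. *)
Definition finite_energy (R : realType) (p : nat)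
    (F : probability 'rV[R]_p R) (X : set 'rV[R]_p) : Prop :=
  (forall x, X x -> F.-integrable setT (fun y => (norm2 (x - y))%:E)) /\
  (F \x F)%E.-integrable setT (fun z => (norm2 (z.1 - z.2))%:E).

(* The expectations are finite, so [fine] loses nothing, under [finite_energy F X] for points P i in X. *)
Definition energy_distance (R : realType) (p : nat)
    (F : probability 'rV[R]_p R) (I : finType) (P : I -> 'rV[R]_p) : R :=
  2 / #|I|%:R * (\sum_i fine 'E_F[fun y => norm2 (P i - y)])
  - 1 / #|I|%:R ^+ 2 * (\sum_i \sum_j norm2 (P i - P j))
  - fine 'E_((F \x F)%E)[fun z => norm2 (z.1 - z.2)].

Definition representative_points (R : realType) (p : nat)
    (F : probability 'rV[R]_p R) (X : set 'rV[R]_p)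
    (I : finType) (P : I -> 'rV[R]_p) : Prop :=
  (forall i, X (P i)) /\
  forall Q : I -> 'rV[R]_p, (forall i, X (Q i)) ->
    energy_distance F P <= energy_distance F Q.

(* Union of indexed families, with the disjoint sum of the index types. *)
Definition union_points (R : realType) (p K : nat) (m : 'I_K -> nat)
    (P : forall k, 'I_(m k) -> 'rV[R]_p) : {k : 'I_K & 'I_(m k)} -> 'rV[R]_p :=
  fun s => P (tag s) (tagged s).

(* Main.v *)
Require Import Defs.
From HB Require Import structures.
From mathcomp Require Import all_boot all_order all_algebra.
From mathcomp Require Import all_classical all_reals all_analysis.
From mathcomp Require Import measurable_realfun.
From mathcomp Require Import ring lra.

Set Implicit Arguments.
Unset Strict Implicit.
Unset Printing Implicit Defensive.

Import Order.TTheory GRing.Theory Num.Theory.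
Import numFieldNormedType.Exports.

Local Open Scope classical_set_scope.
Local Open Scope ring_scope.

(** Write [E(F, Q)] for the energy distance.  Each representative subset of
    size [m] has [E(F, Q) <= D / m], where [D] is the mean distance of two
    independent points of [F]: the average of [E(F, Q)] over random samples of
    size [m] is [D / m], so a greedy choice of points of [X] does as well
    ([greedy_points], [representative_energy_le]).  It remains to see that a
    small energy distance forces the distribution functions to be close, and to
    average over the subsets; those with [c k = 0] carry a vanishing weight.

    That step is usually done with characteristic functions.  Here it is done
    with explicit test functions, by comparing quadratic forms.  Let
    [w x = sqrt (1 + |x|^2)], the distance from [(x, 0)] to the pole [(0, 1)] in
    dimension [p + 1].  On weights of total mass zero, [- |x - y|] gives the
    same quadratic form as [v x y = w x + w y - |x - y|], and with
    [L = w x * w y + 1 + x.y] and [S = w x + w y] the law of cosines reads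
    [v = L / S + v^2 / (2 S)].  Now [L] is a Gram kernel, so is the Cauchy
    kernel [1 / S], and Gram kernels are stable under sums and products; hence
    iterating this equation from [0] gives Gram kernels which increase to [v].
    Moreover [1 / S] exceeds the rank one kernel with function
    [sqrt (2 c) / (w + c)].  Call [phi] dominated when [l * phi (x) phi] is
    below one of these iterates for some [l > 0].  Then
    [l * (mean of phi under F - average of phi over Q)^2 <= E(F, Q)]: for finite
    measures by the above, and for [F] itself by the greedy lemma again, which
    turns positivity on finite point sets into positivity of the mean
    ([dominated_energy], [energy_distance_ge]).

    The same equation makes the dominated functions a vector space stable under
    [phi, psi |-> phi * psi / (w + c)] ([dominatedM]).  So the functions [f] such
    that multiplication by [f] preserves dominated functions form an algebra; it
    contains [(b_k - x_k) / (w + 1)^2], whose sign tells on which side of [b_k]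
    the coordinate [x_k] lies.  Averages of multipliers over representative
    points converge to their means under [F] ([multiplier_average_cvg]), and
    polynomials in these functions approximate the indicator of the orthant
    below [b] from both sides ([multiplier_step], [orthant_cutoff]).  Continuity
    of the distribution function of [F] closes the gap between the two sides
    ([representative_edf_cvg]). *)

(** * Gram kernels and the Cauchy kernel *)

(** A kernel that is explicitly a finite sum of rank one squares.  Unlike mere
    positivity of the quadratic form, this makes stability under pointwise
    products (the Schur product theorem) immediate. *)
Definition gram (R : realType) (I : Type) (M : I -> I -> R) : Prop :=
  exists s : seq (I -> R), forall i j, M i j = \sum_(f <- s) f i * f j.

Lemma eq_gram (R : realType) (I : Type) (M N : I -> I -> R) :
  (forall i j, M i j = N i j) -> gram M -> gram N.
Proof. by move=> e [s h]; exists s => i j; rewrite -e h. Qed.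

Lemma gram_rank1 (R : realType) (I : Type) (f : I -> R) :
  gram (fun i j => f i * f j).
Proof. by exists [:: f] => i j; rewrite big_seq1. Qed.

Lemma gramD (R : realType) (I : Type) (M N : I -> I -> R) :
  gram M -> gram N -> gram (fun i j => M i j + N i j).
Proof.
by move=> [s hs] [t ht]; exists (s ++ t) => i j; rewrite big_cat hs ht.
Qed.

Lemma gramM (R : realType) (I : Type) (M N : I -> I -> R) :
  gram M -> gram N -> gram (fun i j => M i j * N i j).
Proof.
move=> [s hs] [t ht].
exists [seq (fun i => f i * g i) | f <- s, g <- t] => i j.
rewrite big_allpairs_dep hs ht mulr_suml; apply: eq_bigr => f _.
by rewrite mulr_sumr; apply: eq_bigr => g _; ring.
Qed.

Lemma gram_cst (R : realType) (I : Type) (l : R) :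
  0 <= l -> gram (fun _ _ : I => l).
Proof.
move=> l0; apply: eq_gram (gram_rank1 (fun=> Num.sqrt l)) => i j.
by rewrite -expr2 sqr_sqrtr.
Qed.

Lemma gramZ (R : realType) (I : Type) (l : R) (M : I -> I -> R) :
  0 <= l -> gram M -> gram (fun i j => l * M i j).
Proof. by move=> l0; apply: gramM; exact: gram_cst. Qed.

Lemma gram_sum (R : realType) (I J : Type) (s : seq J) (M : J -> I -> I -> R) :
  (forall k, gram (M k)) -> gram (fun i j => \sum_(k <- s) M k i j).
Proof.
move=> h; elim: s => [|k s IHs].
  by apply: eq_gram (gram_cst I (lexx 0)) => i j; rewrite big_nil.
by apply: eq_gram (gramD (h k) IHs) => i j; rewrite big_cons.
Qed.

Lemma gram_quad_ge0 (R : realType) (I : finType) (M : I -> I -> R) (a : I -> R) :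
  gram M -> 0 <= \sum_i \sum_j a i * a j * M i j.
Proof.
move=> [s hs].
have -> : \sum_i \sum_j a i * a j * M i j = \sum_(f <- s) (\sum_i a i * f i) ^+ 2.
  under eq_bigr do under eq_bigr do rewrite hs mulr_sumr.
  under eq_bigr do rewrite exchange_big /=.
  rewrite exchange_big /=; apply: eq_bigr => f _.
  rewrite expr2 mulr_suml; apply: eq_bigr => i _.
  by rewrite mulr_sumr; apply: eq_bigr => j _; ring.
by apply: sumr_ge0 => f _; exact: sqr_ge0.
Qed.

(** What is left of the Cauchy kernel after subtracting a rank one kernel is a
    rescaled Cauchy kernel, which vanishes as soon as [a = c] or [b = c]. *)
Lemma cauchy_identity (R : realType) (a b c : R) : 0 < a -> 0 < b -> 0 < c ->
  (a + b)^-1 =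
  2 * c * ((a + c)^-1 * (b + c)^-1) +
  (a - c) / (a + c) * ((b - c) / (b + c)) * (a + b)^-1.
Proof.
move=> a0 b0 c0; field.
by rewrite !lt0r_neq0// addr_gt0.
Qed.

(** Symmetric elimination: use the identity above with [c] running over all the
    values [al k]; the remainder then vanishes at every index. *)
Lemma gram_cauchy (R : realType) (I : finType) (al : I -> R) :
  (forall i, 0 < al i) -> gram (fun i j => (al i + al j)^-1).
Proof.
move=> al0.
pose r (c a : R) := (a - c) / (a + c).
pose pr (s : seq I) i := \prod_(k <- s) r (al k) (al i).
suff h s : gram (fun i j => (al i + al j)^-1 - pr s i * pr s j * (al i + al j)^-1).
  have pr0 i : pr (enum I) i = 0.
    rewrite /pr (bigD1_seq i) ?enum_uniq ?mem_enum //= /r subrr mul0r.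
    by rewrite mul0r.
  by apply: eq_gram (h (enum I)) => i j; rewrite !pr0; ring.
elim: s => [|k s IHs].
  by apply: eq_gram (gram_cst I (lexx 0)) => i j; rewrite /pr !big_nil; ring.
have k0 : 0 <= 2 * al k by rewrite mulr_ge0// ltW.
apply: eq_gram (gramD IHs (gramM (gram_rank1 (pr s))
  (gramZ k0 (gram_rank1 (fun i => (al i + al k)^-1))))) => i j.
rewrite /pr !big_cons -/(pr s i) -/(pr s j) /r.
rewrite [in RHS](cauchy_identity (al0 i) (al0 j) (al0 k)).
rewrite [in LHS](cauchy_identity (al0 i) (al0 j) (al0 k)).
field.
by rewrite !lt0r_neq0// addr_gt0.
Qed.

(** * The distance kernel as a limit of Gram kernels *)

Section kernel.
Variables (R : realType) (p : nat).
Implicit Types x y : 'rV[R]_p.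

(** The distance from [(x, 0)] to the pole [(0, 1)] one dimension higher.
    Measuring from a pole off the hyperplane keeps all these distances at least
    [1], so that no denominator vanishes. *)
Definition pole_dist x : R := Num.sqrt (1 + \sum_(i < p) x ord0 i ^+ 2).

(** Half the excess of [(pole_dist x + pole_dist y)^2] over [|x - y|^2]; the
    second and third summands are the inner product of [(x, -1)] and
    [(y, -1)]. *)
Definition lifted_dot x y : R :=
  pole_dist x * pole_dist y + 1 + \sum_(i < p) x ord0 i * y ord0 i.

Definition pole_kernel x y : R := pole_dist x + pole_dist y - norm2 (x - y).

(** Iterates from [0] of the equation solved by [pole_kernel], see
    [pole_kernel_fixpoint]; only sums and products of positive kernels occur. *)
Fixpoint pole_approx (n : nat) x y : R :=
  if n is m.+1 then
    lifted_dot x y * (pole_dist x + pole_dist y)^-1 +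
    2^-1 * (pole_approx m x y * pole_approx m x y
            * (pole_dist x + pole_dist y)^-1)
  else 0.

Lemma pole_approxS n x y : pole_approx n.+1 x y =
  lifted_dot x y * (pole_dist x + pole_dist y)^-1 +
  2^-1 * (pole_approx n x y * pole_approx n x y
          * (pole_dist x + pole_dist y)^-1).
Proof. by []. Qed.

Lemma sum_sqr_ge0 x : 0 <= \sum_(i < p) x ord0 i ^+ 2.
Proof. by apply: sumr_ge0 => i _; exact: sqr_ge0. Qed.

Lemma sqr_pole_dist x : pole_dist x ^+ 2 = 1 + \sum_(i < p) x ord0 i ^+ 2.
Proof. by rewrite sqr_sqrtr// addr_ge0// sum_sqr_ge0. Qed.

Lemma pole_dist_ge1 x : 1 <= pole_dist x.
Proof.
by rewrite -[leLHS]sqrtr1 ler_sqrt ?lerDl ?sum_sqr_ge0// addr_ge0// sum_sqr_ge0.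
Qed.

Lemma pole_dist_gt0 x : 0 < pole_dist x.
Proof. exact: lt_le_trans (pole_dist_ge1 x). Qed.

Lemma norm2_ge0 x : 0 <= norm2 x. Proof. exact: sqrtr_ge0. Qed.

Lemma norm2_sym x y : norm2 (x - y) = norm2 (y - x).
Proof.
by congr Num.sqrt; apply: eq_bigr => i _; rewrite !mxE; ring.
Qed.

Lemma norm2_xx x : norm2 (x - x) = 0.
Proof.
rewrite /norm2 big1 ?sqrtr0// => i _.
by rewrite !mxE subrr expr0n.
Qed.

Lemma sqr_norm2B x y :
  norm2 (x - y) ^+ 2 = (pole_dist x + pole_dist y) ^+ 2 - 2 * lifted_dot x y.
Proof.
rewrite sqr_sqrtr ?sum_sqr_ge0// /lifted_dot.
rewrite [RHS](_ : _ = pole_dist x ^+ 2 + pole_dist y ^+ 2 - 2 -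
  2 * \sum_(i < p) x ord0 i * y ord0 i); last by ring.
rewrite !sqr_pole_dist mulr_sumr.
rewrite [RHS](_ : _ = \sum_(i < p) x ord0 i ^+ 2 + \sum_(i < p) y ord0 i ^+ 2 -
  \sum_(i < p) 2 * (x ord0 i * y ord0 i)); last by ring.
rewrite -big_split -sumrB; apply: eq_bigr => i _ /=.
by rewrite !mxE; ring.
Qed.

(** Cauchy-Schwarz, obtained by expanding the sum of the squares of
    [w y * x_i + w x * y_i]. *)
Lemma lifted_dot_ge0 x y : 0 <= lifted_dot x y.
Proof.
have a0 := pole_dist_gt0 x; have b0 := pole_dist_gt0 y.
have h : 0 <= \sum_(i < p)
    (pole_dist y * x ord0 i + pole_dist x * y ord0 i) ^+ 2.
  by apply: sumr_ge0 => i _; exact: sqr_ge0.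
have e : \sum_(i < p) (pole_dist y * x ord0 i + pole_dist x * y ord0 i) ^+ 2 =
   pole_dist y ^+ 2 * (pole_dist x ^+ 2 - 1) +
   pole_dist x ^+ 2 * (pole_dist y ^+ 2 - 1) +
   2 * (pole_dist x * pole_dist y) * (\sum_(i < p) x ord0 i * y ord0 i).
  rewrite [pole_dist x ^+ 2 - 1](_ : _ = \sum_(i < p) x ord0 i ^+ 2); last first.
    by rewrite sqr_pole_dist addrC addKr.
  rewrite [pole_dist y ^+ 2 - 1](_ : _ = \sum_(i < p) y ord0 i ^+ 2); last first.
    by rewrite sqr_pole_dist addrC addKr.
  rewrite !mulr_sumr -!big_split.
  by apply: eq_bigr => i _ /=; ring.
rewrite e /lifted_dot in h *.
have ab0 : 0 < pole_dist x * pole_dist y by rewrite mulr_gt0.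
rewrite -(pmulr_rge0 _ ab0).
nra.
Qed.

Lemma pole_kernel_ge0 x y : 0 <= pole_kernel x y.
Proof.
have := pole_dist_gt0 x; have := pole_dist_gt0 y => b0 a0.
rewrite subr_ge0 -(@ler_pXn2r _ 2)// ?nnegrE ?norm2_ge0 ?addr_ge0 ?(ltW a0) ?(ltW b0)//.
by rewrite sqr_norm2B lerBlDr lerDl mulr_ge0// lifted_dot_ge0.
Qed.

Lemma pole_kernel_fixpoint x y : pole_kernel x y =
  lifted_dot x y * (pole_dist x + pole_dist y)^-1 +
    2^-1 * (pole_kernel x y * pole_kernel x y
            * (pole_dist x + pole_dist y)^-1).
Proof.
have S0 : 0 < pole_dist x + pole_dist y by rewrite addr_gt0 ?pole_dist_gt0.
have e := sqr_norm2B x y.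
rewrite /pole_kernel.
set S := _ + pole_dist y in S0 e *; set r := norm2 _ in e *.
have -> : lifted_dot x y = (S ^+ 2 - r ^+ 2) / 2 by rewrite e; field.
by field; exact: lt0r_neq0.
Qed.

Lemma pole_approx_bounds n x y : 0 <= pole_approx n x y <= pole_kernel x y.
Proof.
have S0 : 0 < pole_dist x + pole_dist y by rewrite addr_gt0 ?pole_dist_gt0.
have Si0 : 0 <= (pole_dist x + pole_dist y)^-1 by rewrite invr_ge0 ltW.
elim: n => [|n /andP[h0 h1]] /=; first by rewrite lexx pole_kernel_ge0.
apply/andP; split.
  by rewrite addr_ge0// ?mulr_ge0// lifted_dot_ge0.
rewrite [leRHS]pole_kernel_fixpoint lerD2l ler_pM2l ?invr_gt0//.
by rewrite ler_wpM2r// ler_pM.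
Qed.

(** The error divided by [2 * (pole_dist x + pole_dist y)] starts below [1 / 2]
    and satisfies [f (n + 1) <= f n * (1 - f n)].  The rate is uniform up to the
    case [x = y], where the equation has a double root. *)
Lemma pole_approx_error n x y :
  pole_kernel x y - pole_approx n x y <=
  2 * (pole_dist x + pole_dist y) / n.+2%:R.
Proof.
have S0 : 0 < pole_dist x + pole_dist y by rewrite addr_gt0 ?pole_dist_gt0.
set S := pole_dist x + pole_dist y in S0 *.
have vS : pole_kernel x y <= S by rewrite lerBlDr lerDl norm2_ge0.
have v0 := pole_kernel_ge0 x y.
pose f m := (pole_kernel x y - pole_approx m x y) / (2 * S).
suff : f n <= n.+2%:R^-1.
  by rewrite ler_pdivrMr ?mulr_gt0// mulrC.
have f0 m : 0 <= f m.
  by rewrite divr_ge0 ?subr_ge0 ?mulr_ge0 ?(ltW S0)//; case/andP: (pole_approx_bounds m x y).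
elim: n => [|n IHn].
  by rewrite /f /= subr0 ler_pdivrMr ?mulr_gt0// mulrA mulVf// mul1r.
have step : f n.+1 <= f n * (1 - f n).
  have [h0 h1] := andP (pole_approx_bounds n x y).
  rewrite /f /= [X in X - _]pole_kernel_fixpoint -/S.
  set v := pole_kernel x y in vS h1 *; set V := pole_approx n x y in h0 h1 *.
  rewrite -subr_ge0.
  rewrite [leRHS](_ : _ = (v - V) * (S - v) / (2 * S ^+ 2)); last first.
    by field; exact: lt0r_neq0.
  by rewrite divr_ge0// ?mulr_ge0 ?subr_ge0// ltW// exprn_gt0.
apply: (le_trans step).
have n0 : 0 < n.+2%:R :> R by rewrite ltr0n.
set q := n.+2%:R in n0 IHn *.
have q2 : 2 <= q by rewrite ler_nat.
have -> : n.+3%:R = q + 1 by rewrite /q [in RHS]natr1.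
have qi : q^-1 <= 2^-1 by rewrite lef_pV2 ?posrE.
have aux (a b : R) : a <= b -> b <= 2^-1 -> a * (1 - a) <= b * (1 - b).
  by move=> ab b2; rewrite -subr_ge0; have : 0 <= (b - a) * (1 - a - b); [
    rewrite mulr_ge0//; lra | nra].
have h := aux _ _ IHn qi.
apply: (le_trans h).
rewrite -subr_ge0 [leRHS](_ : _ = (q ^+ 2 * (q + 1))^-1); last first.
  by field; rewrite !lt0r_neq0 // ltr_wpDr.
by rewrite invr_ge0 mulr_ge0 // ?exprn_ge0 ?ltW// ltr_wpDr.
Qed.

End kernel.

(** * Functions dominated by the distance kernel *)

Section dominated.
Variables (R : realType) (p : nat).
Implicit Types (f phi psi : 'rV[R]_p -> R).
Local Notation w := (@pole_dist R p).

(** A multiple of the rank one kernel of [phi] is below some iterate; that is,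
    [phi] lies in a reproducing kernel space contained in that of
    [pole_kernel].  The constant may not depend on the configuration [x]: this is what
    allows the passage from finite measures to [F]. *)
Definition dominated phi : Prop :=
  exists2 l : R, 0 < l & exists n, forall (I : finType) (x : I -> 'rV[R]_p),
    gram (fun i j => pole_approx n (x i) (x j) - l * (phi (x i) * phi (x j))).

Lemma gram_cauchy_pole (I : finType) (x : I -> 'rV[R]_p) :
  gram (fun i j => (w (x i) + w (x j))^-1).
Proof. by apply: gram_cauchy => i; exact: pole_dist_gt0. Qed.

Lemma gram_cauchy_sub (I : finType) (x : I -> 'rV[R]_p) (c : R) : 0 < c ->
  gram (fun i j => (w (x i) + w (x j))^-1 -
    2 * c * ((w (x i) + c)^-1 * (w (x j) + c)^-1)).
Proof.
move=> c0; apply: eq_gram (gramM (gram_rank1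
  (fun i => (w (x i) - c) / (w (x i) + c))) (gram_cauchy_pole x)) => i j.
by rewrite [in RHS](@cauchy_identity _ _ _ c) ?pole_dist_gt0//; ring.
Qed.

Lemma gram_lifted_dot_sub (I : finType) (x : I -> 'rV[R]_p) :
  [/\ gram (fun i j => lifted_dot (x i) (x j) - 1 * 1),
      gram (fun i j => lifted_dot (x i) (x j) - w (x i) * w (x j)) &
      forall k, gram (fun i j =>
        lifted_dot (x i) (x j) - x i ord0 k * x j ord0 k)].
Proof.
have gw := gram_rank1 (fun i => w (x i)).
have g1 := gram_cst I (@ler01 R).
have gx k := gram_rank1 (fun i => x i ord0 k).
split=> [||k].
- apply: eq_gram (gramD gw (gram_sum (index_enum 'I_p) gx)) => i j.
  by rewrite /lifted_dot; ring.
- apply: eq_gram (gramD g1 (gram_sum (index_enum 'I_p) gx)) => i j.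
  by rewrite /lifted_dot; ring.
- apply: eq_gram (gramD (gramD gw g1)
    (gram_sum (rem k (index_enum 'I_p)) gx)) => i j.
  rewrite /lifted_dot [in RHS](big_rem k) ?mem_index_enum//=.
  by ring.
Qed.

Lemma gram_lifted_dot (I : finType) (x : I -> 'rV[R]_p) :
  gram (fun i j => lifted_dot (x i) (x j)).
Proof.
have [h _ _] := gram_lifted_dot_sub x.
by apply: eq_gram (gramD h (gram_cst I (@ler01 R))) => i j; ring.
Qed.

Lemma gram_pole_approx n (I : finType) (x : I -> 'rV[R]_p) :
  gram (fun i j => pole_approx n (x i) (x j)).
Proof.
elim: n => [|n IHn] /=; first exact: gram_cst.
apply: gramD; first exact: gramM (gram_lifted_dot x) (gram_cauchy_pole x).
apply: gramZ; first by rewrite invr_ge0.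
by apply: gramM (gram_cauchy_pole x); exact: gramM.
Qed.

Lemma gram_pole_approx_incr n m (I : finType) (x : I -> 'rV[R]_p) : (n <= m)%N ->
  gram (fun i j => pole_approx m (x i) (x j) - pole_approx n (x i) (x j)).
Proof.
have step k : gram (fun i j =>
    pole_approx k.+1 (x i) (x j) - pole_approx k (x i) (x j)).
  elim: k => [|k IHk].
    by apply: eq_gram (gram_pole_approx 1 x) => i j /=; ring.
  apply: eq_gram (@gramZ _ _ 2^-1 _ _ (gramM IHk (gramM (gramD (gram_pole_approx k.+1 x)
    (gram_pole_approx k x)) (gram_cauchy_pole x)))) => [i j|]; last first.
    by rewrite invr_ge0.
  rewrite [pole_approx k.+2 _ _]pole_approxS [X in _ = _ - X]pole_approxS.
  by ring.
elim: m => [|m IHm].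
  rewrite leqn0 => /eqP ->.
  by apply: eq_gram (gram_cst I (lexx 0)) => i j; ring.
rewrite leq_eqVlt => /predU1P[->|]; last rewrite ltnS => /IHm h.
  by apply: eq_gram (gram_cst I (lexx 0)) => i j; ring.
by apply: eq_gram (gramD (step m) h) => i j; ring.
Qed.

Lemma dominated_base b (c : R) : 0 < c ->
  (forall (I : finType) (x : I -> 'rV[R]_p),
    gram (fun i j => lifted_dot (x i) (x j) - b (x i) * b (x j))) ->
  dominated (fun x => b x / (w x + c)).
Proof.
move=> c0 hb; exists (2 * c); first by rewrite mulr_gt0.
exists 1%N => I x.
apply: eq_gram (gramD (gramM (hb I x) (gram_cauchy_pole x))
  (gramM (gram_rank1 (fun i => b (x i))) (gram_cauchy_sub x c0))) => i j /=.
by ring.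
Qed.

Lemma dominated_1 (c : R) : 0 < c -> dominated (fun x => 1 / (w x + c)).
Proof.
move=> c0; apply: (@dominated_base (fun=> 1)) => // I x.
by case: (gram_lifted_dot_sub x).
Qed.

Lemma dominated_w (c : R) : 0 < c -> dominated (fun x => w x / (w x + c)).
Proof.
by move=> c0; apply: dominated_base => // I x; case: (gram_lifted_dot_sub x).
Qed.

Lemma dominated_coord k (c : R) : 0 < c ->
  dominated (fun x => x ord0 k / (w x + c)).
Proof.
move=> c0; apply: (@dominated_base (fun x => x ord0 k)) => // I x.
by case: (gram_lifted_dot_sub x).
Qed.

(** The iterates increase, so two dominated functions have a common one. *)
Lemma dominated_common phi psi : dominated phi -> dominated psi ->
  exists2 l : R, 0 < l & exists n, forall (I : finType) (x : I -> 'rV[R]_p),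
    gram (fun i j => pole_approx n (x i) (x j) - l * (phi (x i) * phi (x j))) /\
    gram (fun i j => pole_approx n (x i) (x j) - l * (psi (x i) * psi (x j))).
Proof.
move=> [l l0 [n hn]] [k k0 [m hm]].
have mon f (a b : R) u v : a <= b -> (u <= v)%N ->
  (forall (I : finType) (x : I -> 'rV[R]_p), gram (fun i j =>
     pole_approx u (x i) (x j) - b * (f (x i) * f (x j)))) ->
  forall (I : finType) (x : I -> 'rV[R]_p), gram (fun i j =>
     pole_approx v (x i) (x j) - a * (f (x i) * f (x j))).
  move=> ab uv h I x; rewrite -subr_ge0 in ab.
  apply: eq_gram (gramD (gramD (gram_pole_approx_incr x uv) (h I x))
    (gramZ ab (gram_rank1 (fun i => f (x i))))) => i j.
  by ring.
exists (Num.min l k); first by rewrite lt_min l0.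
exists (maxn n m) => I x; split.
- by apply: mon hn _ _; rewrite ?ge_min ?lexx ?leq_maxl.
- by apply: mon hm _ _; rewrite ?ge_min ?lexx ?leq_maxr ?orbT.
Qed.

Lemma dominatedZ (a : R) phi : dominated phi -> dominated (fun x => a * phi x).
Proof.
move=> [l l0 [n hn]]; have a1 : 0 < 1 + a ^+ 2 by rewrite ltr_wpDr ?sqr_ge0.
exists (l / (1 + a ^+ 2)); first by rewrite divr_gt0.
exists n => I x.
have l1 : 0 <= l / (1 + a ^+ 2) by rewrite divr_ge0// ltW.
apply: eq_gram (gramD (hn I x)
  (gramZ l1 (gram_rank1 (fun i => phi (x i))))) => i j.
by field; exact: lt0r_neq0.
Qed.

Lemma dominatedD phi psi : dominated phi -> dominated psi ->
  dominated (fun x => phi x + psi x).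
Proof.
move=> h1 h2; have [l l0 [n hn]] := dominated_common h1 h2.
exists (l / 4); first by rewrite divr_gt0.
exists n => I x; have [g1 g2] := hn I x.
have l4 : 0 <= l / 4 by rewrite divr_ge0// ltW.
have h0 : 0 <= 2^-1 :> R by rewrite invr_ge0.
(* (phi + psi)^2 + (phi - psi)^2 = 2 phi^2 + 2 psi^2 *)
apply: eq_gram (gramD (gramZ h0 (gramD g1 g2))
  (gramZ l4 (gram_rank1 (fun i => phi (x i) - psi (x i))))) => i j.
by field.
Qed.

(** The next iterate contains the square of the present one times half the
    Cauchy kernel; one factor dominates [phi], the other [psi], and the Cauchy
    kernel dominates [1 / (w + c)]. *)
Lemma dominatedM (c : R) phi psi : 0 < c -> dominated phi -> dominated psi ->
  dominated (fun x => phi x * psi x / (w x + c)).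
Proof.
move=> c0 h1 h2; have [l l0 [n hn]] := dominated_common h1 h2.
exists (c * l ^+ 2); first by rewrite mulr_gt0// exprn_gt0.
exists n.+1 => I x; have [g1 g2] := hn I x.
have h0 : 0 <= 2^-1 :> R by rewrite invr_ge0.
have gC := gram_cauchy_pole x; have gV := gram_pole_approx n x.
have gphi := gramZ (ltW l0) (gram_rank1 (fun i => phi (x i))).
have gpsi := gramZ (ltW l0) (gram_rank1 (fun i => psi (x i))).
apply: eq_gram (gramD (gramM (gram_lifted_dot x) gC) (gramZ h0
  (gramD (gramD (gramM g1 (gramM gV gC)) (gramM gphi (gramM g2 gC)))
    (gramM gphi (gramM gpsi (gram_cauchy_sub x c0)))))) => i j /=.
by field; rewrite !lt0r_neq0// addr_gt0// pole_dist_gt0.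
Qed.

(** Weights of total mass zero do not see the terms [w (x i)] and [w (x j)] of
    [pole_kernel], so the right-hand side is the quadratic form of the limit of
    the iterates. *)
Lemma dominated_energy phi : dominated phi ->
  exists2 l : R, 0 < l & forall (I : finType) (x : I -> 'rV[R]_p) (a : I -> R),
    \sum_i a i = 0 ->
    l * (\sum_i a i * phi (x i)) ^+ 2 <=
    - \sum_i \sum_j a i * a j * norm2 (x i - x j).
Proof.
move=> [l l0 [n hn]]; exists l => // I x a a0.
have kerE : - \sum_i \sum_j a i * a j * norm2 (x i - x j) =
    \sum_i \sum_j a i * a j * pole_kernel (x i) (x j).
  transitivity (\sum_i \sum_j a i * a j * pole_kernel (x i) (x j)
     - \sum_i \sum_j a i * w (x i) * a j - \sum_i \sum_j a i * (a j * w (x j))).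
    rewrite -!sumrB -sumrN; apply: eq_bigr => i _.
    rewrite -!sumrB -sumrN; apply: eq_bigr => j _.
    by rewrite /pole_kernel; ring.
  rewrite [X in _ - X - _]big1 => [|i _]; last by rewrite -mulr_sumr a0 mulr0.
  by under [X in _ - _ - X]eq_bigr do rewrite -mulr_sumr; rewrite -mulr_suml a0 mul0r !subr0.
have sqE : (\sum_i a i * phi (x i)) ^+ 2 =
    \sum_i \sum_j a i * a j * (phi (x i) * phi (x j)).
  rewrite expr2 mulr_suml; apply: eq_bigr => i _.
  by rewrite mulr_sumr; apply: eq_bigr => j _; ring.
rewrite kerE.
set D := \sum_i \sum_j `|a i * a j| * (2 * (w (x i) + w (x j))).
have D0 : 0 <= D.
  apply: sumr_ge0 => i _; apply: sumr_ge0 => j _.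
  by rewrite mulr_ge0// mulr_ge0// addr_ge0// ltW// pole_dist_gt0.
have approx m : (n <= m)%N -> l * (\sum_i a i * phi (x i)) ^+ 2 <=
    \sum_i \sum_j a i * a j * pole_kernel (x i) (x j) + D / m.+2%:R.
  move=> nm; have := gram_quad_ge0 a
    (gramD (hn I x) (gram_pole_approx_incr x nm)).
  have -> : \sum_i \sum_j a i * a j * (pole_approx n (x i) (x j) -
      l * (phi (x i) * phi (x j)) +
      (pole_approx m (x i) (x j) - pole_approx n (x i) (x j))) =
    \sum_i \sum_j a i * a j * pole_approx m (x i) (x j) -
    l * (\sum_i a i * phi (x i)) ^+ 2.
    rewrite sqE mulr_sumr -sumrB; apply: eq_bigr => i _.
    rewrite mulr_sumr -sumrB; apply: eq_bigr => j _.
    by ring.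
  rewrite subr_ge0 => /le_trans; apply.
  rewrite -lerBlDl -sumrB /D mulr_suml; apply: ler_sum => i _.
  rewrite -sumrB mulr_suml; apply: ler_sum => j _.
  rewrite -mulrBr (le_trans (ler_norm _))// normrM -mulrA ler_wpM2l// distrC.
  have /andP[_ h] := pole_approx_bounds m (x i) (x j).
  rewrite ger0_norm ?subr_ge0//.
  exact: pole_approx_error.
apply/ler_addgt0Pr => e e0.
pose m := maxn n (Num.truncn (D / e)).
apply: (le_trans (approx m (leq_maxl _ _))); rewrite lerD2l.
rewrite ler_pdivrMr// -ler_pdivrMl// mulrC.
apply: (le_trans (ltW (truncnS_gt (D / e)))).
by rewrite ler_nat ltnS; apply: leqW; exact: leq_maxr.
Qed.

End dominated.

(** * The algebra of multipliers *)

Section multiplier.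
Variables (R : realType) (p : nat).
Implicit Types (b f g phi psi : 'rV[R]_p -> R).
Local Notation w := (@pole_dist R p).

Lemma measurable_coord (k : 'I_p) :
  measurable_fun setT (fun x : 'rV[R]_p => x ord0 k).
Proof.
move=> _ B mB; rewrite setTI measurable_rVE.
apply: sub_sigma_algebra; rewrite (bigD1 k)//=; left.
by exists B => //; rewrite setTI.
Qed.

Lemma measurable_pole_dist : measurable_fun setT w.
Proof.
apply: (@measurableT_comp _ _ _ _ _ _ (@Num.sqrt R)).
  by apply: continuous_measurable_fun; exact: sqrt_continuous.
apply: measurable_funD => //; apply: measurable_sum => i.
by apply: measurable_funX; exact: measurable_coord.
Qed.

Lemma measurable_pole_inv (c : R) : 0 < c ->
  measurable_fun setT (fun x => (w x + c)^-1).
Proof.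
move=> c0.
rewrite (_ : (fun x => _) = (fun x => powR (w x + c) (-1))); last first.
  apply/funext => x; rewrite powR_inv1//.
  by rewrite addr_ge0 ?(ltW c0)// ltW// pole_dist_gt0.
apply: (measurableT_comp (measurable_powR _)).
by apply: measurable_funD => //; exact: measurable_pole_dist.
Qed.

Definition bounded_measurable f : Prop :=
  measurable_fun setT f /\ exists2 B : R, 0 < B & forall x, `|f x| <= B.

Lemma bounded_measurable_cst (a : R) : bounded_measurable (fun=> a).
Proof.
by split=> //; exists (`|a| + 1) => [|x]; [rewrite ltr_wpDl | rewrite lerDl].
Qed.

Lemma bounded_measurableD f g : bounded_measurable f -> bounded_measurable g ->
  bounded_measurable (fun x => f x + g x).
Proof.
move=> [mf [A A0 fA]] [mg [B B0 gB]]; split; first exact: measurable_funD.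
exists (A + B) => [|x]; first exact: addr_gt0.
by rewrite (le_trans (ler_normD _ _))// lerD.
Qed.

Lemma bounded_measurableM f g : bounded_measurable f -> bounded_measurable g ->
  bounded_measurable (fun x => f x * g x).
Proof.
move=> [mf [A A0 fA]] [mg [B B0 gB]]; split; first exact: measurable_funM.
by exists (A * B) => [|x]; [exact: mulr_gt0 | rewrite normrM ler_pM].
Qed.

Lemma bounded_measurable_inv (c : R) : 0 < c ->
  bounded_measurable (fun x => (w x + c)^-1).
Proof.
move=> c0; split; first exact: measurable_pole_inv.
exists c^-1 => [|x]; first by rewrite invr_gt0.
have w0 := pole_dist_gt0 x; have wc0 : 0 < w x + c by rewrite addr_gt0.
by rewrite ger0_norm ?invr_ge0 ?(ltW wc0)// lef_pV2 ?posrE// lerDr ltW.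
Qed.

Lemma bounded_measurable_ratio b (c : R) : 0 < c -> measurable_fun setT b ->
  (forall x, `|b x| <= w x) -> bounded_measurable (fun x => b x / (w x + c)).
Proof.
move=> c0 mb bw; split.
  by apply: measurable_funM => //; exact: measurable_pole_inv.
exists 1 => // x; have w0 := pole_dist_gt0 x.
have wc0 : 0 < w x + c by rewrite addr_gt0.
rewrite normrM normfV (gtr0_norm wc0) ler_pdivrMr// mul1r.
by rewrite (le_trans (bw x))// lerDl ltW.
Qed.

(** Dominated functions are not closed under products, because of the
    denominator in [dominatedM]; the functions acting on them by multiplication
    are. *)
Definition multiplier f : Prop :=
  bounded_measurable f /\
  forall phi, dominated phi -> dominated (fun x => phi x * f x).

Lemma multiplier_cst (a : R) : multiplier (fun=> a).
Proof.
split=> [|phi hphi]; first exact: bounded_measurable_cst.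
by rewrite (_ : (fun x => _) = fun x => a * phi x);
  [exact: dominatedZ | apply/funext => x; rewrite mulrC].
Qed.

Lemma multiplierD f g : multiplier f -> multiplier g ->
  multiplier (fun x => f x + g x).
Proof.
move=> [bf df] [bg dg]; split=> [|phi hphi]; first exact: bounded_measurableD.
by under eq_fun do rewrite mulrDr; apply: dominatedD; [exact: df | exact: dg].
Qed.

Lemma multiplierM f g : multiplier f -> multiplier g ->
  multiplier (fun x => f x * g x).
Proof.
move=> [bf df] [bg dg]; split=> [|phi hphi]; first exact: bounded_measurableM.
by under eq_fun do rewrite mulrA; apply: dg; exact: df.
Qed.

Lemma multiplierZ (a : R) f : multiplier f -> multiplier (fun x => a * f x).
Proof. by move=> mf; apply: multiplierM => //; exact: multiplier_cst. Qed.

Lemma multiplier_onem f : multiplier f -> multiplier (fun x => 1 - f x).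
Proof.
move=> mf; under eq_fun do rewrite -mulN1r.
by apply: multiplierD; [exact: multiplier_cst | exact: multiplierZ].
Qed.

Lemma multiplierX f n : multiplier f -> multiplier (fun x => f x ^+ n).
Proof.
move=> mf; elim: n => [|n IHn]; first exact: multiplier_cst.
by under eq_fun do rewrite exprS; exact: multiplierM.
Qed.

Lemma multiplier_prod (J : Type) (s : seq J) (f : J -> 'rV[R]_p -> R) :
  (forall k, multiplier (f k)) -> multiplier (fun x => \prod_(k <- s) f k x).
Proof.
move=> mf; elim: s => [|k s IHs].
  by under eq_fun do rewrite big_nil; exact: multiplier_cst.
by under eq_fun do rewrite big_cons; exact: multiplierM.
Qed.

Lemma coord_le_pole_dist (x : 'rV[R]_p) k : `|x ord0 k| <= w x.
Proof.
rewrite -(@ler_pXn2r _ 2)// ?nnegrE// ?(ltW (pole_dist_gt0 x))//.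
rewrite sqr_pole_dist real_normK ?num_real// (bigD1 k)//= addrCA lerDl addr_ge0//.
by apply: sumr_ge0 => i _; exact: sqr_ge0.
Qed.

Lemma multiplier_dominated psi : bounded_measurable psi -> dominated psi ->
  multiplier (fun x => psi x / (w x + 1)).
Proof.
move=> bpsi dpsi; split=> [|phi dphi].
  by apply: bounded_measurableM => //; exact: bounded_measurable_inv.
by under eq_fun do rewrite mulrA; exact: dominatedM.
Qed.

(** The division by [(w + 1)^2] makes the coordinate bounded and, through
    [dominatedM] with [c = 1], a multiplier; it does not change its sign. *)
Lemma multiplier_orthant (q : 'rV[R]_p) k :
  multiplier (fun x => (q ord0 k - x ord0 k) / (w x + 1) ^+ 2).
Proof.
have m1 : multiplier (fun x => 1 / (w x + 1) / (w x + 1)).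
  apply: multiplier_dominated; last exact: dominated_1.
  apply: (@bounded_measurable_ratio (fun=> 1)) => // x.
  by rewrite normr1 pole_dist_ge1.
have mx : multiplier (fun x => x ord0 k / (w x + 1) / (w x + 1)).
  apply: multiplier_dominated; last exact: dominated_coord.
  apply: (@bounded_measurable_ratio (fun x => x ord0 k)) => // [|x].
    exact: measurable_coord.
  exact: coord_le_pole_dist.
have := multiplierD (multiplierZ (q ord0 k) m1) (multiplierZ (-1) mx).
congr multiplier; apply/funext => x; field.
by rewrite lt0r_neq0// addr_gt0// pole_dist_gt0.
Qed.

End multiplier.

Lemma bernoulli_ineq (R : realType) (x : R) n :
  -1 <= x -> 1 + n%:R * x <= (1 + x) ^+ n.
Proof.
move=> x1; elim: n => [|n IHn]; first by rewrite mul0r addr0 expr0.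
have x0 : 0 <= 1 + x by rewrite -lerBlDl sub0r.
rewrite exprS; apply: le_trans (ler_wpM2l x0 IHn).
rewrite -natr1; have : 0 <= n%:R * x ^+ 2 by rewrite mulr_ge0// sqr_ge0.
by nra.
Qed.

Lemma expr_onem_le (R : realType) (s : R) n :
  0 <= s <= 1 -> (1 - s) ^+ n <= (1 + n%:R * s)^-1.
Proof.
move=> /andP[s0 s1].
have ns0 : 0 <= n%:R * s by rewrite mulr_ge0.
rewrite -[leRHS]mul1r ler_pdivlMr ?ltr_wpDr//.
apply: (@le_trans _ _ ((1 - s) ^+ n * (1 + s) ^+ n)).
  rewrite ler_wpM2l ?exprn_ge0 ?subr_ge0//; apply: bernoulli_ineq.
  by rewrite (le_trans _ s0)// lerN10.
rewrite -exprMn exprn_ile1//.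
  by rewrite mulr_ge0 ?subr_ge0// addr_ge0.
by rewrite -subr_sqr expr1n lerBlDr lerDl sqr_ge0.
Qed.

(** A polynomial step function: [1 - (1 - t^n)^(2^n)] is small when [2 t < 1] and
    close to [1] when [2 t > 1], because [2^n * t^n = (2 t)^n].  The affine
    function [t] of [g] takes values in the unit interval and equals [1 / 2] at
    [g = d / 2]. *)
Lemma multiplier_step (R : realType) (p : nat) (g : 'rV[R]_p -> R) (d e : R) :
  multiplier g -> 0 < d -> 0 < e ->
  exists s : 'rV[R]_p -> R, [/\ multiplier s, forall x, 0 <= s x <= 1,
    forall x, g x <= 0 -> s x <= e & forall x, d <= g x -> 1 - e <= s x].
Proof.
move=> mg d0 e0; have [[_ [B B0 gB]] _] := mg.
pose B' := B + d; have B'0 : 0 < B' by rewrite addr_gt0.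
pose eta := d / (2 * B'); have eta0 : 0 < eta by rewrite divr_gt0// mulr_gt0.
pose t x := 2^-1 * (1 + B'^-1 * (g x + - (d / 2))).
have mt : multiplier t.
  apply: multiplierZ; apply: multiplierD; first exact: multiplier_cst.
  apply: multiplierZ; apply: multiplierD => //; exact: multiplier_cst.
have t01 x : 0 <= t x <= 1.
  have /ler_normlP[g1 g2] := gB x.
  have tE : t x = (B' + g x - d / 2) / (2 * B') by rewrite /t; field; exact: lt0r_neq0.
  rewrite tE divr_ge0/=; last 2 first.
  - by rewrite /B'; lra.
  - by rewrite mulr_ge0// ltW.
  by rewrite ler_pdivrMr ?mulr_gt0//; rewrite /B' in g1 g2 *; lra.
(* eta is the distance of 2 t from 1 at g = 0 and at g = d *)
pose m := Num.truncn (e^-1 / eta).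
have hm : (1 + m.+1%:R * eta)^-1 <= e.
  rewrite -[e]invrK lef_pV2 ?posrE ?invr_gt0//; last first.
    by rewrite addr_gt0// mulr_gt0.
  have := truncnS_gt (e^-1 / eta); rewrite ltr_pdivrMr// -/m => /ltW h.
  by rewrite (le_trans h)// lerDr.
pose n := m.+1.
exists (fun x => 1 - (1 - t x ^+ n) ^+ (2 ^ n)%N).
have tn01 x : 0 <= t x ^+ n <= 1.
  have /andP[t0 t1] := t01 x.
  by rewrite exprn_ge0//= exprn_ile1.
have on01 x : 0 <= 1 - t x ^+ n <= 1.
  by have /andP[h0 h1] := tn01 x; rewrite subr_ge0 h1/= lerBlDr lerDl.
have natE x : (2 ^ n)%N%:R * t x ^+ n = (2 * t x) ^+ n by rewrite natrX -exprMn.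
split=> [|x|x gx|x gx].
- by apply: multiplier_onem; apply: multiplierX; apply: multiplier_onem;
    exact: multiplierX.
- have /andP[h0 h1] := on01 x.
  by rewrite subr_ge0 exprn_ile1//= lerBlDr lerDl exprn_ge0.
- apply: le_trans hm.
  have /andP[h0 h1] := tn01 x.
  have := @bernoulli_ineq _ (- t x ^+ n) (2 ^ n)%N.
  rewrite lerN2 h1 mulrN natE => /(_ isT) h.
  apply: (@le_trans _ _ ((2 * t x) ^+ n)); first by lra.
  have t2 : 2 * t x <= 1 - eta.
    have -> : 1 - eta = 2 * (2^-1 * (1 + B'^-1 * (0 + - (d / 2)))).
      by rewrite /eta; field; exact: lt0r_neq0.
    by rewrite /t !ler_pM2l// ?invr_gt0// lerD2l ler_pM2l ?invr_gt0// lerD2r.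
  have t0 : 0 <= 2 * t x by rewrite mulr_ge0//; case/andP: (t01 x).
  have eta1 : 0 <= eta <= 1.
    by rewrite (ltW eta0)/=; lra.
  apply: le_trans (expr_onem_le n eta1).
  by rewrite lerXn2r ?nnegrE// (le_trans t0).
- have h := expr_onem_le (2 ^ n)%N (tn01 x).
  rewrite lerD2l lerN2 (le_trans h)//.
  apply: le_trans hm; rewrite natE.
  have t2 : 1 + eta <= 2 * t x.
    have -> : 1 + eta = 2 * (2^-1 * (1 + B'^-1 * (d + - (d / 2)))).
      by rewrite /eta; field; exact: lt0r_neq0.
    by rewrite /t !ler_pM2l// ?invr_gt0// lerD2l ler_pM2l ?invr_gt0// lerD2r.
  have eta1 : 0 <= 1 + eta by rewrite addr_ge0// ltW.
  rewrite lef_pV2 ?posrE; last 2 first.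
  - by rewrite ltr_wpDr// exprn_ge0// (le_trans eta1).
  - by rewrite addr_gt0// mulr_gt0.
  have := @bernoulli_ineq _ eta n.
  rewrite (le_trans _ (ltW eta0)) ?lerN10// => /(_ isT) h2.
  apply: (le_trans h2); rewrite (@le_trans _ _ ((2 * t x) ^+ n))// ?lerDr//.
  by rewrite lerXn2r ?nnegrE// (le_trans eta1).
Qed.

(** * Means and greedily chosen points *)

Section mean.
Context d (T : measurableType d) (R : realType) (P : probability T R).
Implicit Types (f g : T -> R) (X : set T).

(** Integrability and value together, so that a mean is computed along the
    structure of the function. *)
Definition has_mean f (l : R) : Prop :=
  P.-integrable setT (EFin \o f) /\ \int[P]_(x in setT) f x = l.

Lemma has_mean_cst (a : R) : has_mean (fun=> a) a.
Proof.
split; first exact: finite_measure_integrable_cst.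
by rewrite /Rintegral integral_cst//= probability_setT mule1.
Qed.

Lemma has_meanD f g a b : has_mean f a -> has_mean g b ->
  has_mean (fun x => f x + g x) (a + b).
Proof.
move=> [fi <-] [gi <-]; split; last by rewrite RintegralD.
by rewrite (_ : _ \o _ = (EFin \o f) \+ (EFin \o g))%E//; exact: integrableD.
Qed.

Lemma has_meanZ (k : R) f a : has_mean f a -> has_mean (fun x => k * f x) (k * a).
Proof.
move=> [fi <-]; split; last by rewrite RintegralZl.
by rewrite (_ : _ \o _ = (fun x => k%:E * (EFin \o f) x)%E)//; exact: integrableZl.
Qed.

Lemma has_meanB f g a b : has_mean f a -> has_mean g b ->
  has_mean (fun x => f x - g x) (a - b).
Proof.
move=> hf /(has_meanZ (-1)); under eq_fun do rewrite mulN1r.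
by rewrite mulN1r; exact: has_meanD.
Qed.

Lemma has_mean_sum (I : Type) (s : seq I) (f : I -> T -> R) (a : I -> R) :
  (forall i, has_mean (f i) (a i)) ->
  has_mean (fun x => \sum_(i <- s) f i x) (\sum_(i <- s) a i).
Proof.
move=> h; elim: s => [|i s IHs].
  by rewrite big_nil; under eq_fun do rewrite big_nil; exact: has_mean_cst.
by rewrite big_cons; under eq_fun do rewrite big_cons; exact: has_meanD.
Qed.

Lemma has_mean_bounded f (B : R) : measurable_fun setT f ->
  (forall x, `|f x| <= B) -> has_mean f (\int[P]_(x in setT) f x).
Proof.
move=> mf fB; split=> //.
apply: measurable_bounded_integrable => //.
  by rewrite (le_lt_trans (probability_le1 P _))// ltry.
exists B; split; first exact: num_real.
by move=> M BM x _; exact: le_trans (fB x) (ltW BM).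
Qed.

Lemma has_mean_indic (A : set T) : measurable A ->
  has_mean (\1_A : T -> R) (fine (P A)).
Proof.
move=> mA; have h : has_mean (\1_A : T -> R) (\int[P]_(x in setT) \1_A x).
  apply: (@has_mean_bounded _ 1); first exact: measurable_indic.
  by move=> x; rewrite indicE; case: (x \in A); rewrite ?normr1 ?normr0.
by split; [case: h | rewrite /Rintegral integral_indic// setIT].
Qed.

Lemma le_has_mean f g a b : has_mean f a -> has_mean g b ->
  (forall x, f x <= g x) -> a <= b.
Proof. by move=> [fi <-] [gi <-] fg; apply: le_Rintegral. Qed.

(** Otherwise [f - l] would be almost everywhere positive with integral zero. *)
Lemma has_mean_witness X f l : {ae P, forall x, X x} -> has_mean f l ->
  exists x, X x /\ f x <= l.
Proof.
move=> aeX hf; apply: contrapT => nex.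
have ltf x : X x -> l < f x.
  by move=> Xx; rewrite ltNge; apply/negP => h; apply: nex; exists x.
have [gi g0] := has_meanB hf (has_mean_cst l).
rewrite subrr in g0.
have mg : measurable_fun setT (fun x => (f x - l)%:E).
  exact: (measurable_int P gi).
have e0 : (\int[P]_(x in setT) `|(f x - l)%:E| = 0)%E.
  transitivity (\int[P]_(x in setT) (f x - l)%:E)%E.
    apply: ae_eq_integral => //; first exact: measurableT_comp.
    apply: filterS aeX => x Xx _.
    by rewrite gee0_abs// lee_fin subr_ge0 ltW// ltf.
  rewrite -[LHS]fineK; first by rewrite [fine _]g0.
  exact: integrable_fin_num.
have aef : {ae P, forall x, False}.
  have := (ae_eq_integral_abs P measurableT mg).1 e0.
  move=> h; apply: filterS2 aeX h => x /ltf lx /(_ I) [] /eqP.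
  by rewrite subr_eq0 => /eqP fx; rewrite fx ltxx in lx.
have PT0 : (0 < P setT)%E by rewrite probability_setT.
exact: (@filter_not_empty _ _ (ae_properfilter_algebraOfSetsType PT0)).
Qed.

(** The bound is the mean of the double sum over [M] independent points: [M]
    diagonal terms of mean [c] and [M * (M - 1)] others of mean [H].  The points
    are chosen one at a time so that the conditional mean, given those already
    chosen, never increases. *)
Lemma greedy_points X (h : T -> T -> R) (hP : T -> R) (H c : R) :
  {ae P, forall x, X x} -> (forall x y, h x y = h y x) ->
  (forall x, X x -> has_mean (h x) (hP x)) -> has_mean hP H ->
  has_mean (fun x => h x x) c ->
  forall M : nat, exists q : M.-tuple T, (forall i, X (tnth q i)) /\
    \sum_(x <- q) \sum_(y <- q) h x y <= M%:R ^+ 2 * H + M%:R * (c - H).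
Proof.
move=> aeX hsym hmean meanH meanc M.
(* the left-hand side below is the conditional mean after N choices *)
suff step N : (N <= M)%N -> exists q : N.-tuple T, (forall i, X (tnth q i)) /\
    \sum_(x <- q) \sum_(y <- q) h x y +
    2 * (M - N)%:R * (\sum_(x <- q) hP x) + (M - N)%:R ^+ 2 * H +
    (M - N)%:R * (c - H) <= M%:R ^+ 2 * H + M%:R * (c - H).
  have [q [Xq hq]] := step M (leqnn M); exists q; split=> //.
  by apply: le_trans hq; rewrite subnn; nra.
elim: N => [|N IHN] NM.
  exists [tuple]; split=> [[]//|].
  by rewrite !big_nil subn0; nra.
have [q [Xq hq]] := IHN (ltnW NM).
set A := \sum_(x <- q) _ in hq; set B := \sum_(x <- q) hP x in hq.
have KE : (M - N)%:R = (M - N.+1)%:R + 1 :> R by rewrite natr1 subnSK.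
set K := (M - N.+1)%:R in KE.
have Xq' y : y \in tval q -> X y by move=> /tnthP[i ->]; exact: Xq.
have meanq : has_mean (fun x => \sum_(y <- q) h y x) B.
  suff qs s : {subset s <= tval q} ->
      has_mean (fun x => \sum_(y <- s) h y x) (\sum_(y <- s) hP y) by exact: qs.
  elim: s => [_|y s IHs sq].
    by rewrite big_nil; under eq_fun do rewrite big_nil; exact: has_mean_cst.
  rewrite big_cons; under eq_fun do rewrite big_cons.
  apply: has_meanD; first by apply: hmean; apply: Xq'; apply: sq; rewrite mem_head.
  by apply: IHs => z zs; apply: sq; rewrite inE zs orbT.
have := has_meanD (has_meanD (has_meanD (has_mean_cst (A + 2 * K * B + K ^+ 2 * H + K * (c - H)))
  (has_meanZ 2 meanq)) meanc) (has_meanZ (2 * K) meanH).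
move=> /(has_mean_witness aeX)[x [Xx hx]].
exists (cons_tuple x q); split=> [i|].
  have := mem_tnth i (cons_tuple x q); rewrite inE => /predU1P[->//|].
  exact: Xq'.
have -> : \sum_(x0 <- cons_tuple x q) \sum_(y <- cons_tuple x q) h x0 y =
    A + 2 * (\sum_(y <- q) h y x) + h x x.
  rewrite /= !big_cons.
  under [X in _ + X]eq_bigr do rewrite big_cons.
  rewrite big_split /= -/A.
  under [X in h x x + X]eq_bigr do rewrite hsym.
  by ring.
rewrite /= big_cons -/B -/K.
rewrite KE in hq; nra.
Qed.

End mean.

(** * Energy distance to a distribution *)

Section transfer.
Variables (R : realType) (p : nat) (X : set 'rV[R]_p).
Variable F : probability 'rV[R]_p R.
Hypothesis F_on_X : {ae F, forall x, X x}.
Hypothesis F_energy : finite_energy F X.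

Definition potential (x : 'rV[R]_p) : R := fine 'E_F[fun y => norm2 (x - y)].

Definition self_energy : R := fine 'E_((F \x F)%E)[fun z => norm2 (z.1 - z.2)].

Lemma has_mean_norm2 x : X x -> has_mean F (fun y => norm2 (x - y)) (potential x).
Proof.
by move=> Xx; split; [exact: F_energy.1 | rewrite /potential unlock].
Qed.

(** Fubini gives integrability of the extended real potential, which is finite
    only almost everywhere; taking [fine] changes it on a null set. *)
Lemma has_mean_potential : has_mean F potential self_energy.
Proof.
have iz := F_energy.2.
pose f (z : 'rV[R]_p * 'rV[R]_p) : \bar R := (norm2 (z.1 - z.2))%:E.
have ig : F.-integrable setT (fubini_F F f) by exact: integrable_fubini_F.
have mg : measurable_fun setT (fubini_F F f) := measurable_int F ig.
have potE x : potential x = fine (fubini_F F f x) by rewrite /potential unlock.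
have mp : measurable_fun setT (EFin \o potential).
  apply/measurable_EFinP; rewrite (_ : potential = fine \o fubini_F F f).
    by apply: measurableT_comp => //; exact: fine_measurable.
  by apply/funext => x; rewrite potE.
have aeE : {ae F, forall x, (EFin \o potential) x = fubini_F F f x}.
  have := integrable_ae measurableT ig.
  by apply: filterS => x /(_ I) fx; rewrite /= potE fineK.
have ip : F.-integrable setT (EFin \o potential).
  apply: le_integrable ig => // x _.
  rewrite /= potE; case: (fubini_F F f x) => [r|//|//] /=.
  - by [].
  - by rewrite normr0 leey.
  - by rewrite normr0 leey.
split=> //; rewrite /self_energy unlock /Rintegral; congr fine.
rewrite -integral12_prod_meas1//.
apply: ae_eq_integral => //.
by apply: filterS aeE => x ex _.
Qed.

Definition average (I : finType) (Q : I -> 'rV[R]_p) (f : 'rV[R]_p -> R) : R :=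
  (\sum_i f (Q i)) / #|I|%:R.

Lemma energy_distanceE (I : finType) (Q : I -> 'rV[R]_p) :
  energy_distance F Q = 2 * average Q potential -
    average Q (fun x => average Q (fun y => norm2 (x - y))) - self_energy.
Proof.
rewrite /energy_distance /average /potential -/self_energy.
congr (_ - _ - _); first by rewrite mulrAC mulrA.
by rewrite -mulr_suml; case: (#|I|%:R =P 0 :> R) => [->|/eqP I0];
  [rewrite expr0n/= invr0 !mulr0 mul0r | field].
Qed.

(** The double sum of [h] over [Q] is [m^2 * E(F, Q)] for a point set of size
    [m].  The partial means of [h] vanish and its diagonal has mean
    [self_energy], so greedy points reach [self_energy / m]. *)
Lemma representative_energy_le m (Q : 'I_m.+1 -> 'rV[R]_p) :
  representative_points F X Q -> energy_distance F Q <= self_energy / m.+1%:R.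
Proof.
move=> [_ repr].
pose h x y := potential x + potential y - norm2 (x - y) - self_energy.
have hmean x : X x -> has_mean F (h x) 0.
  move=> Xx; rewrite (_ : 0 = potential x + self_energy - potential x - self_energy).
    apply: has_meanB (has_mean_cst _ _); apply: has_meanB; last exact: has_mean_norm2.
    by apply: has_meanD (has_mean_cst _ _) _; exact: has_mean_potential.
  by ring.
have hdiag : has_mean F (fun x => h x x) self_energy.
  have := has_meanB (has_meanZ 2 has_mean_potential) (has_mean_cst F self_energy).
  congr has_mean; last by ring.
  by apply/funext => x; rewrite /h norm2_xx; ring.
have hsym x y : h x y = h y x by rewrite /h norm2_sym; ring.
have [q [Xq hq]] := greedy_points F_on_X hsym hmean (has_mean_cst F 0) hdiag m.+1.
apply: le_trans (repr (tnth q) Xq) _.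
have M0 : m.+1%:R != 0 :> R by rewrite pnatr_eq0.
move: hq; rewrite mulr0 add0r subr0 !big_tuple => hq.
rewrite -(@ler_pM2l _ (m.+1%:R ^+ 2)) ?exprn_gt0 ?ltr0n//.
rewrite [leRHS](_ : _ = m.+1%:R * self_energy); last by field.
apply: le_trans hq; rewrite le_eqVlt; apply/orP; left; apply/eqP.
rewrite energy_distanceE /average card_ord.
under [RHS]eq_bigr do rewrite big_tuple.
rewrite [RHS](_ : _ = \sum_i (m.+1%:R * potential (tnth q i) +
  \sum_j potential (tnth q j) - \sum_j norm2 (tnth q i - tnth q j) -
  m.+1%:R * self_energy)); last first.
  apply: eq_bigr => i _; rewrite /h !sumrB big_split /= !sumr_const !card_ord.
  by rewrite !mulr_natl.
rewrite !sumrB big_split /= -mulr_sumr !sumr_const !card_ord -!mulr_suml.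
rewrite -[_ *+ m.+1]mulr_natl -[(_ * self_energy) *+ _]mulr_natl.
by field.
Qed.

(** For [F] replaced by a finite point set [q] this is [dominated_energy] with
    weights [1] on the [M] points of [q] and [- M / #|I|] on [Q]; it says that the double sums of [h]
    over [q] are nonnegative.  If the mean [H] of [h] under two independent
    copies of [F] were negative, greedy points would make such a sum
    negative. *)
Lemma energy_distance_ge (phi : 'rV[R]_p -> R) :
  dominated phi -> bounded_measurable phi ->
  exists2 l : R, 0 < l & forall (I : finType) (Q : I -> 'rV[R]_p) a,
    (0 < #|I|)%N -> (forall i, X (Q i)) -> has_mean F phi a ->
    l * (a - average Q phi) ^+ 2 <= energy_distance F Q.
Proof.
move=> dphi [mphi [B B0 phiB]].
have [l l0 hl] := dominated_energy dphi.
exists l => // I Q a I0 XQ mean_phi.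
have n0 : #|I|%:R != 0 :> R by rewrite pnatr_eq0 -lt0n.
pose A x := average Q (fun y => norm2 (x - y)).
pose b := average Q A.
pose psi x := phi x - average Q phi.
pose h x y := A x + A y - norm2 (x - y) - b - l * psi x * psi y.
have mean_psi : has_mean F psi (a - average Q phi).
  exact: has_meanB (has_mean_cst _ _).
have mean_A : has_mean F A (average Q potential).
  rewrite /A /average; under eq_fun do rewrite mulrC; rewrite mulrC.
  apply: has_meanZ; apply: has_mean_sum => i.
  by under eq_fun do rewrite norm2_sym; exact: has_mean_norm2.
pose H := energy_distance F Q - l * (a - average Q phi) ^+ 2.
pose hF x := A x + average Q potential - potential x - b -
  l * psi x * (a - average Q phi).
have hmean x : X x -> has_mean F (h x) (hF x).
  move=> Xx; apply: has_meanB; last exact: has_meanZ.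
  apply: has_meanB (has_mean_cst _ _); apply: has_meanB; last exact: has_mean_norm2.
  exact: has_meanD (has_mean_cst _ _) _.
have meanH : has_mean F hF H.
  have := has_meanB (has_meanB (has_meanB (has_meanD mean_A
    (has_mean_cst F (average Q potential))) has_mean_potential)
    (has_mean_cst F b)) (has_meanZ (l * (a - average Q phi)) mean_psi).
  congr has_mean; last by rewrite /H energy_distanceE -/b; ring.
  by apply/funext => x; rewrite /hF; ring.
have mean_psi2 : exists c, has_mean F (fun x => psi x ^+ 2) c.
  have bpsi : bounded_measurable psi.
    by apply: bounded_measurableD; [split; [|exists B] | exact: bounded_measurable_cst].
  have [m2 [B2 _ h2]] := bounded_measurableM bpsi bpsi.
  by eexists; exact: has_mean_bounded m2 h2.
have [c2 mean_c2] := mean_psi2.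
pose c := 2 * average Q potential - b - l * c2.
have meanc : has_mean F (fun x => h x x) c.
  have := has_meanB (has_meanB (has_meanZ 2 mean_A) (has_mean_cst F b))
    (has_meanZ l mean_c2).
  by congr has_mean; apply/funext => x; rewrite /h norm2_xx; ring.
have hsym x y : h x y = h y x by rewrite /h norm2_sym; ring.
have h_ge0 M (q : M.-tuple 'rV[R]_p) : 0 <= \sum_(x <- q) \sum_(y <- q) h x y.
  pose t := M%:R / #|I|%:R : R.
  pose x (i : 'I_M + I) := match i with inl i => tnth q i | inr j => Q j end.
  pose w (i : 'I_M + I) : R := match i with inl _ => 1 | inr j => - t end.
  have sumE g : \sum_i w i * g (x i) = \sum_(x <- q) g x - M%:R * average Q g.
    rewrite big_sumType /= big_tuple; congr (_ + _).
      by under eq_bigr do rewrite mul1r.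
    by rewrite -mulr_sumr /average /t; field.
  have sum1 : \sum_i w i = 0.
    have := sumE (fun=> 1); under eq_bigr do rewrite mulr1.
    move=> ->; rewrite big_tuple /average !sumr_const card_ord.
    by rewrite mulfV// mulr1 subrr.
  pose S := \sum_(u <- q) \sum_(v <- q) norm2 (u - v).
  pose SA := \sum_(u <- q) A u.
  have sumN : \sum_i \sum_j w i * w j * norm2 (x i - x j) =
      S - 2 * M%:R * SA + M%:R ^+ 2 * b.
    pose G u := \sum_(v <- q) norm2 (u - v) - M%:R * A u.
    transitivity (\sum_i w i * G (x i)).
      apply: eq_bigr => i _; rewrite /G /A -(sumE (fun v => norm2 (x i - v))).
      by rewrite mulr_sumr; apply: eq_bigr => j _; rewrite mulrA.
    rewrite sumE.
    have -> : \sum_(u <- q) G u = S - M%:R * SA by rewrite sumrB -mulr_sumr.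
    have -> : average Q G = SA - M%:R * b.
      rewrite /average sumrB mulrBl -mulr_sumr -mulrA; congr (_ - _).
      rewrite exchange_big mulr_suml; apply: eq_bigr => v _.
      by rewrite /A /average; under eq_bigr do rewrite norm2_sym.
    by ring.
  pose Spsi := \sum_(u <- q) psi u.
  have sumh : \sum_(u <- q) \sum_(v <- q) h u v =
      2 * M%:R * SA - S - M%:R ^+ 2 * b - l * Spsi ^+ 2.
    have sumc (k : R) : \sum_(u <- q) k = M%:R * k.
      by rewrite big_tuple sumr_const card_ord mulr_natl.
    transitivity (\sum_(u <- q) (M%:R * A u + SA - \sum_(v <- q) norm2 (u - v)
      - M%:R * b - l * Spsi * psi u)).
      apply: eq_bigr => u _.
      rewrite /h !sumrB big_split /= !sumc -mulr_sumr -/SA -/Spsi.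
      by congr (_ - _); ring.
    rewrite !sumrB big_split /= !sumc -!mulr_sumr -/S -/SA -/Spsi.
    by ring.
  have sum_psi : Spsi = \sum_(u <- q) phi u - M%:R * average Q phi.
    by rewrite /Spsi sumrB [X in _ - X]big_tuple sumr_const card_ord mulr_natl.
  have := hl _ x w sum1; rewrite sumE sumN sumh sum_psi; lra.
rewrite -subr_ge0 -/H leNgt; apply/negP => H0.
pose M := (Num.truncn ((c - H) / - H)).+1.
have [q [_ hq]] := greedy_points F_on_X hsym hmean meanH meanc M.
have := le_trans (h_ge0 _ q) hq; apply/negP; rewrite -ltNge.
have := truncnS_gt ((c - H) / - H); rewrite ltr_pdivrMr ?oppr_gt0// -/M => hM.
have M0 : 0 < M%:R :> R by rewrite ltr0n.
have : 0 < M%:R * (M%:R * - H - (c - H)) by rewrite mulr_gt0// subr_gt0.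
nra.
Qed.

End transfer.

(** * Cutoff functions of orthants *)

Lemma prod_unit_ge (R : realType) (J : Type) (r : seq J) (s : J -> R) :
  (forall k, 0 <= s k <= 1) ->
  1 - \sum_(k <- r) (1 - s k) <= \prod_(k <- r) s k.
Proof.
move=> s01; elim: r => [|k r IHr]; first by rewrite !big_nil subr0.
rewrite !big_cons; have /andP[s0 s1] := s01 k.
have pr1 : \prod_(j <- r) s j <= 1 by apply: prodr_ile1 => j _; exact: s01.
have : 0 <= (1 - s k) * (1 - \prod_(j <- r) s j) by rewrite mulr_ge0 ?subr_ge0.
by nra.
Qed.

Section orthant.
Variables (R : realType) (p : nat) (b : 'rV[R]_p).

Definition orthant_coord (k : 'I_p) (x : 'rV[R]_p) : R :=
  (b ord0 k - x ord0 k) / (pole_dist x + 1) ^+ 2.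

Definition orthant_level (t : R) : set 'rV[R]_p :=
  [set x | forall k, t <= orthant_coord k x].

Lemma measurable_orthant_level t : measurable (orthant_level t).
Proof.
have -> : orthant_level t =
    \bigcap_(k in [set: 'I_p]) (orthant_coord k @^-1` `[t, +oo[).
  apply/seteqP; split=> x /= h k; first by move=> _; rewrite /= in_itv/= h.
  by have := h k I; rewrite /= in_itv/= andbT.
apply: fin_bigcap_measurable; first exact: finite_finset.
move=> k _; rewrite -[_ @^-1` _]setTI.
by have [[mk _] _] := multiplier_orthant b k; apply: mk.
Qed.

(** A product of polynomial steps, one per coordinate. *)
Lemma orthant_cutoff (t d e : R) : 0 < d -> 0 < e ->
  exists G : 'rV[R]_p -> R, [/\ multiplier G,
    forall x, 0 <= G x <= 1,
    forall x, orthant_level (t + d) x -> 1 - e <= G x &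
    forall x, ~ orthant_level t x -> G x <= e].
Proof.
move=> d0 e0; pose e' := e / p.+1%:R.
have e'0 : 0 < e' by rewrite divr_gt0.
have e'e : e' <= e by rewrite ler_pdivrMr// ler_peMr ?ler1n// ltW.
have /choice[s hs] k : exists s : 'rV[R]_p -> R, [/\ multiplier s,
    forall x, 0 <= s x <= 1,
    forall x, orthant_coord k x - t <= 0 -> s x <= e' &
    forall x, d <= orthant_coord k x - t -> 1 - e' <= s x].
  apply: multiplier_step => //; apply: multiplierD; last exact: multiplier_cst.
  exact: multiplier_orthant.
have s01 k x : 0 <= s k x <= 1 by case: (hs k).
exists (fun x => \prod_(k < p) s k x); split=> [|x|x Lx|x nLx].
- by apply: multiplier_prod => k; case: (hs k).
- rewrite prodr_ge0 => [|k _]; last by case/andP: (s01 k x).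
  by apply: prodr_ile1 => k _; exact: s01.
- apply: le_trans (prod_unit_ge _ (fun k => s01 k x)).
  rewrite lerD2l lerN2; apply: (@le_trans _ _ (\sum_(k < p) e')).
    apply: ler_sum => k _; have [_ _ _ h] := hs k.
    have : 1 - e' <= s k x by apply: h; rewrite lerBrDl.
    lra.
  rewrite sumr_const card_ord -mulr_natl /e' mulrCA ler_piMr ?(ltW e0)//.
  by rewrite ler_pdivrMr// mul1r ler_nat.
- have [k hk] : exists k, orthant_coord k x < t.
    apply: contrapT => nex; apply: nLx => k.
    by rewrite leNgt; apply/negP => hk; apply: nex; exists k.
  apply: le_trans e'e; have [_ _ h _] := hs k.
  apply: le_trans (h x _); last by rewrite subr_le0 ltW.
  rewrite (bigD1 k)//= ler_piMr//; first by case/andP: (s01 k x).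
  by apply: prodr_ile1 => j _; exact: s01.
Qed.

Lemma orthant_level0 : orthant_level 0 = [set x | lev x b].
Proof.
have h k x : (0 <= orthant_coord k x) = (x ord0 k <= b ord0 k).
  by rewrite pmulr_lge0 ?subr_ge0// invr_gt0 exprn_gt0// addr_gt0// pole_dist_gt0.
apply/seteqP; split=> x /= hx; first by apply/forallP => k; rewrite -h.
by move=> k; rewrite h; exact: (forallP hx).
Qed.

Lemma edf_average (I : finType) (Q : I -> 'rV[R]_p) :
  edf Q b = average Q (\1_(orthant_level 0)).
Proof.
rewrite /edf /average; congr (_ / _).
rewrite -sum1_card natr_sum big_mkcond; apply: eq_bigr => i _.
rewrite indicE orthant_level0 inE /=.
by case: ifPn => h; [rewrite mem_set | rewrite memNset//; apply/negP].
Qed.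

Lemma measurable_lev : measurable [set x | lev x b].
Proof. by rewrite -orthant_level0; exact: measurable_orthant_level. Qed.

End orthant.

(** * Convergence of representative point sets *)

Section convergence.
Variables (R : realType) (p : nat) (X : set 'rV[R]_p).
Variable F : probability 'rV[R]_p R.
Hypothesis F_on_X : {ae F, forall x, X x}.
Hypothesis F_energy : finite_energy F X.

Lemma le_average (I : finType) (Q : I -> 'rV[R]_p) (f g : 'rV[R]_p -> R) :
  (forall x, f x <= g x) -> average Q f <= average Q g.
Proof. by move=> fg; rewrite ler_wpM2r ?invr_ge0//; apply: ler_sum => i _. Qed.

Lemma average_shift (I : finType) (Q : I -> 'rV[R]_p) (f : 'rV[R]_p -> R) (a : R) :
  (0 < #|I|)%N -> average Q (fun x => f x + a) = average Q f + a.
Proof.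
move=> I0; rewrite /average big_split /= mulrDl sumr_const -[a *+ _]mulr_natr.
by rewrite mulfK// pnatr_eq0 -lt0n.
Qed.

(** A multiplier [f] need not be dominated, but [w / (w + c) * f] is, and it tends
    to [f] uniformly as [c] goes to [0]. *)
Lemma multiplier_average_cvg (f : 'rV[R]_p -> R) (a e : R) :
  multiplier f -> has_mean F f a -> 0 < e ->
  exists N : nat, forall m (Q : 'I_m.+1 -> 'rV[R]_p), (N <= m)%N ->
    representative_points F X Q -> `|average Q f - a| <= e.
Proof.
move=> mf meanf e0; have [[mmf [B B0 fB]] df] := mf.
pose c := e / 4 / B; have c0 : 0 < c by rewrite !divr_gt0.
pose phi x := pole_dist x / (pole_dist x + c) * f x.
have dphi : dominated phi by apply: df; exact: dominated_w.
have bphi : bounded_measurable phi.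
  apply: bounded_measurableM; last by split=> //; exists B.
  apply: bounded_measurable_ratio => //; first exact: measurable_pole_dist.
  by move=> x; rewrite ger0_norm// ltW// pole_dist_gt0.
have close x : `|f x - phi x| <= e / 4.
  have w1 := pole_dist_ge1 x.
  have wc0 : 0 < pole_dist x + c by rewrite addr_gt0// pole_dist_gt0.
  have -> : f x - phi x = c / (pole_dist x + c) * f x.
    by rewrite /phi; field; exact: lt0r_neq0.
  have -> : e / 4 = c * B by rewrite /c divfK// lt0r_neq0.
  rewrite normrM ler_pM// (ger0_norm (divr_ge0 (ltW c0) (ltW wc0))).
  by rewrite ler_pdivrMr// ler_peMr ?(ltW c0)//; lra.
have up : forall x, f x <= phi x + e / 4.
  by move=> x; have /ler_normlP[_ h] := close x; rewrite -lerBlDl.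
have lo : forall x, phi x <= f x + e / 4.
  by move=> x; have /ler_normlP[h _] := close x; rewrite -lerBlDl -opprB.
have [mphi [B' _ phiB]] := bphi.
have mean_phi := has_mean_bounded F mphi phiB.
set a' := (\int[F]_(x in _) _)%R in mean_phi.
have a1 : a <= a' + e / 4.
  exact: le_has_mean meanf (has_meanD mean_phi (has_mean_cst _ _)) up.
have a2 : a' <= a + e / 4.
  exact: le_has_mean mean_phi (has_meanD meanf (has_mean_cst _ _)) lo.
have [l l0 hl] := energy_distance_ge F_on_X F_energy dphi bphi.
have le0 : 0 < l * (e / 2) ^+ 2 by rewrite mulr_gt0// exprn_gt0// divr_gt0.
exists (Num.truncn (self_energy F / (l * (e / 2) ^+ 2))) => m Q Nm repr.
have I0 : (0 < #|'I_m.+1|)%N by rewrite card_ord.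
have b1 := le_average Q up; have b2 := le_average Q lo.
rewrite !average_shift// in b1 b2.
have h : l * (a' - average Q phi) ^+ 2 <= l * (e / 2) ^+ 2.
  apply: le_trans (hl _ Q a' I0 repr.1 mean_phi) _.
  apply: le_trans (representative_energy_le F_on_X F_energy repr) _.
  rewrite ler_pdivrMr// mulrC -ler_pdivrMr//.
  apply: le_trans (ltW (truncnS_gt _)) _.
  by rewrite ler_nat ltnS.
rewrite ler_pM2l// in h.
have e2 : 0 <= e / 2 by rewrite divr_ge0// ltW.
have {h} : `|a' - average Q phi| <= e / 2.
  by rewrite -(@ler_pXn2r _ 2)// ?nnegrE// real_normK ?num_real.
move=> /ler_normlP[h1 h2]; apply/ler_normlP; split; lra.
Qed.

Lemma orthant_level_below (b : 'rV[R]_p) (e : R) : 0 < e -> exists2 d : R, 0 < d &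
  fine (F (orthant_level b (- d))) <= mcdf F b + e.
Proof.
move=> e0; pose A n := orthant_level b (- n.+1%:R^-1).
have mA n : measurable (A n) by exact: measurable_orthant_level.
have capA : \bigcap_n A n = [set x | lev x b].
  rewrite -orthant_level0; apply/seteqP; split=> x /= h.
    move=> k; rewrite leNgt; apply/negP => hk.
    have := h (Num.truncn (- orthant_coord b k x)^-1) I k.
    apply/negP; rewrite -ltNge ltrNr invf_plt ?posrE ?oppr_gt0//.
    exact: truncnS_gt.
  by move=> n _ k; rewrite (le_trans _ (h k))// oppr_le0.
have niA : nonincreasing_seq A.
  move=> n m nm; apply/subsetPset => x h k; apply: le_trans (h k).
  by rewrite lerN2 lef_pV2 ?posrE// ler_nat.
have F0 : (F (A 0%N) < +oo)%E by rewrite (le_lt_trans (probability_le1 F _))// ltry.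
have := nonincreasing_cvg_mu F0 mA (bigcapT_measurable mA) niA.
rewrite capA -[X in _ --> X]fineK ?fin_num_measure//; last exact: measurable_lev.
move=> /fine_cvg /cvgrPdist_le /(_ e e0) [n _ /(_ n (leqnn n))] /=.
move=> /ler_normlP[h _]; exists n.+1%:R^-1; first by rewrite invr_gt0.
by rewrite /mcdf -lerBlDl -opprB.
Qed.

(** The open orthant below [b] is the increasing union of the levels [d > 0].  It
    contains the closed orthants below points slightly smaller than [b], whose
    mass is close to that of the orthant at [b] by continuity. *)
Lemma orthant_level_above (F_cont : continuous (mcdf F)) (b : 'rV[R]_p) (e : R) : 0 < e ->
  exists2 d : R, 0 < d & mcdf F b - e <= fine (F (orthant_level b d)).
Proof.
move=> e0; pose A n := orthant_level b n.+1%:R^-1.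
have mA n : measurable (A n) by exact: measurable_orthant_level.
have mU : measurable (\bigcup_n A n) by exact: bigcup_measurable.
have e20 : 0 < e / 2 by rewrite divr_gt0.
have [eta eta0 Feta] : exists2 eta : R, 0 < eta &
    mcdf F b - e / 2 <= mcdf F (b - const_mx eta).
  have /cvgrPdist_le /(_ _ e20) /nbhs_ballP[r /= r0 hr] := F_cont b.
  exists (r / 2); first by rewrite divr_gt0.
  have /ler_normlP[_ h] : `|mcdf F b - mcdf F (b - const_mx (r / 2))| <= e / 2.
    apply: hr; split=> // i j; rewrite /ball /= !mxE opprB addrC subrK.
    by rewrite gtr0_norm ?divr_gt0// ltr_pdivrMr// ltr_pMr// ltr1n.
  by lra.
have subA : [set x | lev x (b - const_mx eta)] `<=` \bigcup_n A n.
  move=> x /= /forallP hx; have w0 := pole_dist_gt0 x.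
  have w10 : 0 < (pole_dist x + 1) ^+ 2 by rewrite exprn_gt0// addr_gt0.
  exists (Num.truncn ((pole_dist x + 1) ^+ 2 / eta)) => // k.
  apply: (@le_trans _ _ (eta / (pole_dist x + 1) ^+ 2)).
    rewrite -[leRHS]invrK lef_pV2 ?posrE ?invr_gt0 ?divr_gt0// invf_div.
    exact: ltW (truncnS_gt _).
  rewrite ler_pM2r ?invr_gt0//.
  by have := hx k; rewrite !mxE; lra.
have ndA : nondecreasing_seq A.
  move=> n m nm; apply/subsetPset => x h k; apply: le_trans (h k).
  by rewrite lef_pV2 ?posrE// ler_nat.
have le_fine (A1 A2 : set 'rV[R]_p) : measurable A1 -> measurable A2 ->
    A1 `<=` A2 -> fine (F A1) <= fine (F A2).
  by move=> m1 m2 s12; rewrite fine_le ?fin_num_measure// le_measure ?inE.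
have := @nondecreasing_cvg_mu _ _ _ F _ mA mU ndA.
rewrite -[X in _ --> X]fineK ?fin_num_measure//.
move=> /fine_cvg /cvgrPdist_le /(_ _ e20) [n _ /(_ n (leqnn n))] /=.
move=> /ler_normlP[_ h]; exists n.+1%:R^-1; first by rewrite invr_gt0.
have := le_fine _ _ (measurable_lev _) mU subA; rewrite -/(mcdf F _) -/(A n).
lra.
Qed.

(** [G1] is a cutoff of the orthant from outside, equal to about [1] on it and
    to about [0] off the level [- d1]; [G2] is one from inside, about [1] on the
    level [d2] and about [0] off the orthant. *)
Lemma representative_edf_cvg (F_cont : continuous (mcdf F))
    (b : 'rV[R]_p) (e : R) : 0 < e ->
  exists N : nat, forall m (Q : 'I_m.+1 -> 'rV[R]_p), (N <= m)%N ->
    representative_points F X Q -> `|edf Q b - mcdf F b| <= e.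
Proof.
move=> e0; pose e4 := e / 4; have e40 : 0 < e4 by rewrite divr_gt0.
have meanL t := has_mean_indic F (measurable_orthant_level b t).
have indT (A : set 'rV[R]_p) x : A x -> \1_A x = 1 :> R.
  by move=> Ax; rewrite indicE mem_set.
have indF (A : set 'rV[R]_p) x : ~ A x -> \1_A x = 0 :> R.
  by move=> Ax; rewrite indicE memNset.
have [d1 d10 hd1] := orthant_level_below b e40.
have [d2 d20 hd2] := orthant_level_above F_cont b e40.
have [G1 [mG1 G101 G1in G1out]] := orthant_cutoff b (- d1) d10 e40.
have [G2 [mG2 G201 G2in G2out]] := orthant_cutoff b 0 d20 e40.
rewrite addNr in G1in; rewrite add0r in G2in.
have bnd (G : 'rV[R]_p -> R) (G01 : forall x, 0 <= G x <= 1) x : `|G x| <= 1.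
  by have /andP[? ?] := G01 x; rewrite ger0_norm.
have mean1 := has_mean_bounded F mG1.1.1 (bnd _ G101).
have mean2 := has_mean_bounded F mG2.1.1 (bnd _ G201).
set a1 := (\int[F]_(x in _) G1 x)%R in mean1.
set a2 := (\int[F]_(x in _) G2 x)%R in mean2.
have [N1 hN1] := multiplier_average_cvg mG1 mean1 e40.
have [N2 hN2] := multiplier_average_cvg mG2 mean2 e40.
have ha1 : a1 <= fine (F (orthant_level b (- d1))) + e4.
  apply: le_has_mean mean1 (has_meanD (meanL _) (has_mean_cst _ _)) _ => x.
  have /andP[g0 g1] := G101 x.
  have [Lx|Lx] := pselect (orthant_level b (- d1) x).
    by rewrite indT//; lra.
  by rewrite indF//; have := G1out x Lx; lra.
have ha2 : fine (F (orthant_level b d2)) <= a2 + e4.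
  apply: le_has_mean (meanL _) (has_meanD mean2 (has_mean_cst _ _)) _ => x.
  have /andP[g0 g1] := G201 x.
  have [Lx|Lx] := pselect (orthant_level b d2 x).
    by rewrite indT//; have := G2in x Lx; lra.
  by rewrite indF//; lra.
exists (maxn N1 N2) => m Q; rewrite geq_max => /andP[N1m N2m] repr.
have I0 : (0 < #|'I_m.+1|)%N by rewrite card_ord.
have h1 : edf Q b <= average Q G1 + e4.
  rewrite edf_average -average_shift//; apply: le_average => x.
  have /andP[g0 g1] := G101 x.
  have [Lx|Lx] := pselect (orthant_level b 0 x).
    by rewrite indT//; have := G1in x Lx; lra.
  by rewrite indF//; lra.
have h2 : average Q G2 <= edf Q b + e4.
  rewrite edf_average -average_shift//; apply: le_average => x.
  have /andP[g0 g1] := G201 x.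
  have [Lx|Lx] := pselect (orthant_level b 0 x).
    by rewrite indT//; lra.
  by rewrite indF//; have := G2out x Lx; lra.
have /ler_normlP[k1 k2] := hN1 m Q N1m repr.
have /ler_normlP[k3 k4] := hN2 m Q N2m repr.
rewrite /e4 in hd1 hd2 ha1 ha2 h1 h2 k1 k2 k3 k4.
by apply/ler_normlP; split; lra.
Qed.

End convergence.

(** * Unions of point sets *)

Lemma card_tag_sum (I : finType) (J : I -> finType) (S : pred {i : I & J i}) :
  #|S| = (\sum_(i : I) #|[pred j : J i | S (Tagged J j)]|)%N.
Proof.
rewrite -sum1_card.
under [RHS]eq_bigr do rewrite -sum1_card.
rewrite (sig_big_dep _ (fun i (j : J i) => S (Tagged J j)))/=.
by apply: eq_bigl => -[i j].
Qed.

Lemma edf_union (R : realType) (p K : nat) (m : 'I_K -> nat)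
    (P : forall k, 'I_(m k) -> 'rV[R]_p) (x : 'rV[R]_p) :
  (forall k, (0 < m k)%N) ->
  edf (union_points P) x =
  \sum_(k < K) (m k)%:R / (\sum_(k < K) m k)%N%:R * edf (P k) x.
Proof.
move=> m0; rewrite /edf.
pose J k : finType := 'I_(m k).
have -> : #|{: {k : 'I_K & J k}}| = (\sum_(k < K) m k)%N.
  rewrite (card_tag_sum (J := J)); apply: eq_bigr => k _.
  by rewrite -[RHS]card_ord; apply: eq_card.
rewrite (card_tag_sum (J := J)) natr_sum mulr_suml; apply: eq_bigr => k _.
have mk : (m k)%:R != 0 :> R by rewrite pnatr_eq0 -lt0n.
pose N : R := #|[pred i | lev (P k i) x]|%:R.
rewrite card_ord -/N -[LHS]/(N / _).
by rewrite [RHS]mulrC mulrA divfK.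
Qed.

Lemma edf_unit (R : realType) (p : nat) (I : finType) (P : I -> 'rV[R]_p)
  (x : 'rV[R]_p) : 0 <= edf P x <= 1.
Proof.
rewrite /edf divr_ge0//=; have [->|I0] := eqVneq #|I| 0%N.
  by rewrite invr0 mulr0.
by rewrite ler_pdivrMr ?ltr0n ?lt0n// mul1r ler_nat max_card.
Qed.

Lemma mcdf_unit (R : realType) (p : nat) (F : probability 'rV[R]_p R)
  (x : 'rV[R]_p) : 0 <= mcdf F x <= 1.
Proof.
rewrite /mcdf fine_ge0//= -lee_fin fineK ?probability_le1//.
  exact: measurable_lev.
by rewrite fin_num_measure//; exact: measurable_lev.
Qed.

Theorem theorem2 (R : realType) (p K : nat)
  (X : set 'rV[R]_p) (F : probability 'rV[R]_p R)
  (F_on_X : {ae F, forall x, X x})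
  (F_continuous : continuous (mcdf F))
  (F_energy : finite_energy F X)
  (nk : 'I_K -> nat -> nat)
  (nk_gt0 : forall n, (K <= n)%N -> forall k, (0 < nk k n)%N)
  (nk_sum : forall n, (K <= n)%N -> n = (\sum_(k < K) nk k n)%N)
  (c : 'I_K -> R)
  (nk_lim : forall k, (nk k n)%:R / n%:R @[n --> \oo] --> c k)
  (P : forall (n : nat) (k : 'I_K), 'I_(nk k n) -> 'rV[R]_p)
  (P_in_X : forall n, (K <= n)%N -> forall k i, X (P n k i))
  (P_representative : forall k, 0 < c k ->
     forall n, (K <= n)%N -> representative_points F X (P n k)) :
  cvg_in_distribution (fun n => edf (union_points (P n))) (mcdf F).
Proof.
move=> x _; apply/cvgrPdist_le => e e0.
pose e' := e / K.+1%:R; have e'0 : 0 < e' by rewrite divr_gt0.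
have ratio k n : (K < n)%N -> let r : R := (nk k n)%:R / n%:R in 0 <= r <= 1.
  move=> Kn /=; rewrite divr_ge0//= ler_pdivrMr ?ltr0n ?(leq_ltn_trans _ Kn)//.
  rewrite mul1r ler_nat [leqRHS](nk_sum n (ltnW Kn)).
  by rewrite (bigD1 k)//= leq_addr.
(* the deviation of the union is the weighted sum of those of the subsets *)
have terms k : \forall n \near \oo,
    `|(nk k n)%:R / n%:R * (edf (P n k) x - mcdf F x)| <= e'.
  have Kn : \forall n \near \oo, (K < n)%N by exists K.+1.
  have [ck0|ck0] := ltP 0 (c k); last first.
    (* a share tending to 0 contributes little wherever its points lie *)
    have /cvgrPdist_le /(_ e' e'0) hc := nk_lim k.
    near=> n.
    have Kn' : (K < n)%N by near: n; exact: Kn.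
    have /andP[r0 r1] := ratio k n Kn'.
    have /andP[u0 u1] := edf_unit (P n k) x.
    have /andP[v0 v1] := mcdf_unit F x.
    have h : `|c k - (nk k n)%:R / n%:R| <= e' by near: n.
    have {h} h : (nk k n)%:R / n%:R <= e'.
      by have /ler_normlP[h1 _] := h; lra.
    rewrite normrM (ger0_norm r0) -[leRHS]mulr1 ler_pM//.
    by apply/ler_normlP; split; lra.
  have [N hN] := representative_edf_cvg F_on_X F_energy F_continuous x e'0.
  have c20 : 0 < c k / 2 by rewrite divr_gt0.
  have /cvgrPdist_le /(_ _ c20) hc := nk_lim k.
  have nN : \forall n \near \oo, N.+1%:R / (c k / 2) <= n%:R :> R.
    by exists (Num.truncn (N.+1%:R / (c k / 2))).+1 => // n /=;
      rewrite -(ler_nat R); apply: le_trans; exact: ltW (truncnS_gt _).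
  near=> n.
  have Kn' : (K < n)%N by near: n; exact: Kn.
  have n0 : 0 < n%:R :> R by rewrite ltr0n (leq_ltn_trans _ Kn').
  have /andP[r0 r1] := ratio k n Kn'.
  have h : `|c k - (nk k n)%:R / n%:R| <= c k / 2 by near: n.
  have {h} h : c k / 2 <= (nk k n)%:R / n%:R.
    by have /ler_normlP[_ h1] := h; lra.
  have Nk : (N < nk k n)%N.
    rewrite -(ler_nat R); rewrite ler_pdivlMr// in h; apply: le_trans h.
    by rewrite mulrC -ler_pdivrMr//; near: n.
  have hQ m (Q : 'I_m -> 'rV[R]_p) : (N < m)%N -> representative_points F X Q ->
      `|edf Q x - mcdf F x| <= e'.
    by case: m Q => // m Q Nm; exact: hN.
  rewrite normrM (ger0_norm r0) -[leRHS]mul1r ler_pM//.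
  by apply: hQ => //; apply: P_representative => //; exact: ltnW.
have /filter_forall all_terms := terms.
near=> n.
have Kn : (K < n)%N by near: n; exists K.+1.
have n0 : n%:R != 0 :> R by rewrite pnatr_eq0 -lt0n (leq_ltn_trans _ Kn).
rewrite edf_union; last exact: nk_gt0 (ltnW Kn).
rewrite -(nk_sum n (ltnW Kn)).
have sum1 : \sum_(k < K) (nk k n)%:R / n%:R = 1 :> R.
  by rewrite -mulr_suml -natr_sum -(nk_sum n (ltnW Kn)) mulfV.
rewrite distrC -[mcdf F x]mul1r -[X in X * mcdf F x]sum1 mulr_suml -sumrB.
under eq_bigr do rewrite -mulrBr.
apply: le_trans (ler_norm_sum _ _ _) _.
apply: (@le_trans _ _ (\sum_(k < K) e')).
  by apply: ler_sum => k _; move: k; near: n.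
rewrite sumr_const card_ord -mulr_natl /e' mulrCA ler_piMr ?(ltW e0)//.
by rewrite ler_pdivrMr// mul1r ler_nat.
Unshelve. all: by end_near.
Qed.
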